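(* Let $n \ge 1$ and let $\mathcal{C}$ be a line complex in $\mathbb{Z}_2^n$, with associated graph $G(\mathcal{C})$. Suppose that: (1) every point of $\mathbb{Z}_2^n$ lies on at least one line in $\mathcal{C}$; (2) the graph $G(\mathcal{C})$ contains no even cycle; and (3) no connected component of $G(\mathcal{C})$ is a tree. Then the X-ray transform restricted to $\mathcal{C}$, $R_{\mathcal{C}} \colon \mathbb{C}^{\mathbb{Z}_2^n} \to \mathbb{C}^{\mathcal{C}}$, is injective; equivalently, $\mathcal{C}$ is admissible.
   Context: An affine line in $\mathbb{Z}_2^n$ is a set $\{x, x+v\}$ with $x \in \mathbb{Z}_2^n$ and $v \in \mathbb{Z}_2^n \setminus \{0\}$; thus lines are exactly the unordered pairs of distinct points of $\mathbb{Z}_2^n$. A line complex is a subset $\mathcal{C}$ of the set of all lines. For $f \colon \mathbb{Z}_2^n \to \mathbb{C}$ and a line $L$, $Rf(L) = \sum_{x \in L} f(x)$, and $R_{\mathcal{C}} f = (Rf(L))_{L \in \mathcal{C}}$. The complex $\mathcal{C}$ is admissible if the linear map $R_{\mathcal{C}} \colon \mathbb{C}^{\mathbb{Z}_2^n} \to \mathbb{C}^{\mathcal{C}}$ is injective. The graph $G(\mathcal{C})$ has vertex set $\mathbb{Z}_2^n$, and two distinct vertices $x,y$ are adjacent iff $\{x,y\} \in \mathcal{C}$. A cycle is a simple closed path (of length at least 3); it is even or odd according to its length. A tree is a connected acyclic graph. *)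

(* Defs.v *)
From mathcomp Require Import all_boot all_order all_algebra.
From mathcomp Require Import reals complex.

Set Implicit Arguments.
Unset Strict Implicit.
Unset Printing Implicit Defensive.

Import GRing.Theory.
Local Open Scope ring_scope.

Section Graphs.
Variable T : finType.

(* A simple graph on T is a symmetric irreflexive relation.  A cycle is given
   by its cyclic sequence of pairwise distinct vertices, not repeating the
   starting point, so its length is the size of the sequence. *)
Definition is_cycle (e : rel T) (c : seq T) : bool :=
  (3 <= size c)%N && ucycleb e c.

Definition no_even_cycle (e : rel T) : Prop :=
  forall c : seq T, is_cycle e c -> odd (size c).

Definition is_component (e : rel T) (A : {set T}) : Prop :=
  exists x : T, A = [set y | connect e x y].

Definition induced (e : rel T) (A : {set T}) : rel T :=
  [rel x y | [&& x \in A, y \in A & e x y]].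

Definition is_tree (e : rel T) (A : {set T}) : Prop :=
  [/\ A != set0,
      {in A &, forall x y, connect (induced e A) x y} &
      forall c : seq T, ~~ is_cycle (induced e A) c].

End Graphs.

Definition lines (n : nat) : {set {set 'rV['Z_2]_n}} :=
  [set L | [exists x : 'rV['Z_2]_n, exists v : 'rV['Z_2]_n,
              (v != 0) && (L == [set x; x + v])]].

Definition line_graph (n : nat) (C : {set {set 'rV['Z_2]_n}}) :
    rel 'rV['Z_2]_n :=
  [rel x y | (x != y) && ([set x; y] \in C)].

Definition xray (R : realType) (n : nat) (f : {ffun 'rV['Z_2]_n -> complex R})
    (L : {set 'rV['Z_2]_n}) : complex R :=
  \sum_(x in L) f x.

Definition restricted_xray (R : realType) (n : nat)
    (C : {set {set 'rV['Z_2]_n}}) (f : {ffun 'rV['Z_2]_n -> complex R}) :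
    {ffun {L : {set 'rV['Z_2]_n} | L \in C} -> complex R} :=
  [ffun L => xray f (val L)].

Definition admissible (R : realType) (n : nat)
    (C : {set {set 'rV['Z_2]_n}}) : Prop :=
  injective (@restricted_xray R n C).

(* Main.v *)
Require Import Defs.
From mathcomp Require Import all_boot all_order all_algebra.
From mathcomp Require Import reals complex.

(** By linearity, the difference [h] of two functions with the same restricted
    transform satisfies [h x + h y = 0] on every edge of the graph.  Hence [h]
    changes sign along each edge ([alternating_path]), so that it vanishes at
    every vertex of an odd cycle ([alternating_odd_cycle]) and, if it vanishes
    at one vertex, it vanishes on the whole connected component.

    Suppose that [h x] is nonzero.  Then no odd cycle meets the component of
    [x]; even cycles are excluded by hypothesis; so this component is connected
    and acyclic, i.e. a tree, which is also excluded
    ([alternating_eq0]). *)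

Set Implicit Arguments.
Unset Strict Implicit.
Unset Printing Implicit Defensive.

Import GRing.Theory Num.Theory.
Local Open Scope ring_scope.

Section Components.
Variables (T : finType) (e : rel T).

Lemma induced_sub (A : {set T}) : subrel (induced e A) e.
Proof. by move=> x y /and3P[]. Qed.

Lemma induced_sym (A : {set T}) : symmetric e -> symmetric (induced e A).
Proof. by move=> sym_e x y; rewrite /induced /= sym_e andbCA. Qed.

Lemma is_cycle_induced (A : {set T}) (c : seq T) :
  is_cycle (induced e A) c -> is_cycle e c.
Proof.
case/and3P=> size_c cyc_c uniq_c; apply/and3P; split=> //.
exact: sub_cycle (@induced_sub A) _ cyc_c.
Qed.

(** A component is defined through paths in the whole graph, but a tree has to
    be connected within its own vertex set; the two agree because a path cannot
    leave the component of its origin. *)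
Lemma connect_in_component (x y : T) :
  connect e x y -> connect (induced e [set z | connect e x z]) x y.
Proof.
case/connectP=> p; elim/last_ind: p y => [|p z IHp] y /=; first by move=> _ ->.
rewrite rcons_path last_rcons => /andP[path_p e_z] ->.
apply: connect_trans (IHp _ path_p erefl) (connect1 _).
have con_last: connect e x (last x p) by apply/connectP; exists p.
by rewrite /induced /= !inE con_last e_z (connect_trans con_last (connect1 e_z)).
Qed.

End Components.

Section Alternating.
Variables (T : finType) (e : rel T) (K : numDomainType) (h : T -> K).
Hypothesis h_alt : forall x y, e x y -> h x + h y = 0.

Lemma alternating_path (x : T) (p : seq T) :
  path e x p -> h (last x p) = (-1) ^+ size p * h x.
Proof.
elim: p x => [|y p IHp] x /=; first by rewrite expr0 mul1r.
case/andP=> /h_alt h_xy /IHp ->.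
rewrite exprSr -mulrA mulN1r; congr (_ * _).
by apply/eqP; rewrite -addr_eq0 addrC h_xy.
Qed.

Lemma alternating_connect0 (x y : T) : connect e x y -> h y = 0 -> h x = 0.
Proof.
case/connectP=> p /alternating_path h_p -> /eqP.
by rewrite h_p mulrI_eq0 ?signr_eq0 // => [/eqP|]; last exact: lreg_sign.
Qed.

(** Going once around the cycle gives [h y = - h y]. *)
Lemma alternating_odd_cycle (y : T) (p : seq T) :
  cycle e (y :: p) -> odd (size (y :: p)) -> h y = 0.
Proof.
move=> /= /alternating_path; rewrite last_rcons size_rcons -signr_odd => h_y odd_p.
by move/eqP: h_y; rewrite /= odd_p expr1 mulN1r eq_sym eqNr => /eqP.
Qed.

Hypotheses (sym_e : symmetric e) (e_no_even : no_even_cycle e).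
Hypothesis e_no_tree : forall A : {set T}, is_component e A -> ~ is_tree e A.

(** A cycle in the component of [x] is odd, so [h] vanishes on it and then also
    at [x].  Hence [h x] can only be nonzero if the component has no cycle, but
    then it is a tree. *)
Lemma alternating_eq0 (x : T) : h x = 0.
Proof.
apply/eqP/negPn/negP => hx_neq0.
apply: (e_no_tree (A := [set y | connect e x y])); first by exists x.
split=> [|a b|c].
- by apply/set0Pn; exists x; rewrite inE.
- rewrite !inE => /connect_in_component x_a /connect_in_component x_b.
  apply: connect_trans x_b.
  by rewrite (sym_connect_sym (induced_sym _ sym_e)).
apply/negP=> cyc_c; have cyc_e := is_cycle_induced cyc_c.
have odd_c := e_no_even cyc_e.
case: c cyc_c cyc_e odd_c => [|y p] //.
move=> /and3P[_ cyc_yp _] /and3P[_ cyc_e _] odd_c.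
(* The first edge of an induced cycle has both endpoints in the component. *)
have: y \in [set y | connect e x y].
  by move: cyc_yp; case: (p) => [|z q] /= /andP[/and3P[]].
rewrite inE => x_y; case/eqP: hx_neq0.
exact: alternating_connect0 x_y (alternating_odd_cycle cyc_e odd_c).
Qed.

End Alternating.

Lemma line_graph_sym (n : nat) (C : {set {set 'rV['Z_2]_n}}) :
  symmetric (line_graph C).
Proof. by move=> x y; rewrite /line_graph /= eq_sym setUC. Qed.

Lemma xray_pair (R : realType) (n : nat) (f : {ffun 'rV['Z_2]_n -> complex R})
  (x y : 'rV['Z_2]_n) : x != y -> xray f [set x; y] = f x + f y.
Proof. by move=> x_neq_y; rewrite /xray big_setU1 ?inE //= big_set1. Qed.

Theorem theorem1p4 (R : realType) (n : nat) (C : {set {set 'rV['Z_2]_n}})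
  (n_ge1 : (1 <= n)%N)
  (C_lines : C \subset lines n)
  (C_covers : forall x : 'rV['Z_2]_n, exists2 L, L \in C & x \in L)
  (C_no_even : no_even_cycle (line_graph C))
  (C_no_tree : forall A : {set 'rV['Z_2]_n},
     is_component (line_graph C) A -> ~ is_tree (line_graph C) A) :
  admissible R C.
Proof.
move=> f g eq_fg; apply/ffunP=> x; apply/eqP; rewrite -subr_eq0; apply/eqP.
apply: (alternating_eq0 (e := line_graph C) (h := fun y => f y - g y)) => //.
- move=> y z /andP[y_neq_z yz_in].
  move/ffunP/(_ (exist (fun L => L \in C) _ yz_in)): eq_fg; rewrite !ffunE /= !xray_pair // => eq_yz.
  by rewrite addrACA eq_yz -opprD subrr.
- exact: line_graph_sym.
Qed.
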